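(* Let $t\equiv 2 \pmod 4$ and let $\alpha,\beta\in A_t$ with $\alpha\neq\mathrm{id}$ and $\beta\neq\mathrm{id}$. Then for every $m$ there is a 1-local function $f:(A_t)^m\to(A_t)^{O(tm)}$, computable by a fan-in-2 Boolean circuit of depth $O(\log t)$, such that for all $x=(x_1,\ldots,x_m)\in(A_t)^m$: if $\prod_i x_i=\alpha$ then $\prod_i f(x)_i=\beta$, and if $\prod_i x_i=\mathrm{id}$ then $\prod_i f(x)_i=\mathrm{id}$.
   Context: $A_t$ is the alternating group on $\{1,\ldots,t\}$ with identity $\mathrm{id}$; permutations are encoded in pointwise representation $(\sigma(1),\ldots,\sigma(t))$. Products $\prod_i x_i$ are taken in index order $x_1x_2\cdots$. A function $f:(A_t)^m\to(A_t)^n$ is 1-local if each output coordinate $f(x)_j$ depends on only one input coordinate $x_i$. The constants in $O(tm)$ and $O(\log t)$ are absolute. *)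

(* Defs.v *)
From mathcomp Require Import all_boot all_fingroup all_solvable.

Set Implicit Arguments.
Unset Strict Implicit.
Unset Printing Implicit Defensive.

(* A_t acts on 'I_t = {0, ..., t-1}.  In a product of permutations the left
   factor is applied first: (s * u) i = u (s i). *)
Definition altg (t : nat) := [subg 'Alt_('I_t)].

Definition vprod (t n : nat) (x : n.-tuple (altg t)) : altg t :=
  (\prod_(i < n) tnth x i)%g.

Definition one_local (T : Type) (m n : nat) (f : m.-tuple T -> n.-tuple T) :=
  forall j : 'I_n, exists i : 'I_m, forall x y : m.-tuple T,
    tnth x i = tnth y i -> tnth (f x) j = tnth (f y) j.

(* Fan-in-2 Boolean circuits with k inputs, as DAGs in topological order.
   Wires are numbered: 0, ..., k-1 are the inputs, and the j-th gate (from 0)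
   drives wire k + j, reading only wires of smaller number. *)
Inductive gate :=
  | GConst of bool
  | GNot of nat
  | GAnd of nat & nat
  | GOr of nat & nat.

Definition gate_reads (g : gate) : seq nat :=
  match g with
  | GConst _ => [::]
  | GNot a => [:: a]
  | GAnd a b | GOr a b => [:: a; b]
  end.

Fixpoint gates_wf (w : nat) (gs : seq gate) : bool :=
  if gs is g :: gs' then
    all (fun a => a < w) (gate_reads g) && gates_wf w.+1 gs'
  else true.

Record circuit (k : nat) := Circuit {
  gates : seq gate;
  outputs : seq nat;
  gates_ok : gates_wf k gates;
  outputs_ok : all (fun a => a < k + size gates) outputs
}.

Definition gate_val (v : seq bool) (g : gate) : bool :=
  match g with
  | GConst b => b
  | GNot a => ~~ nth false v a
  | GAnd a b => nth false v a && nth false v b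
  | GOr a b => nth false v a || nth false v b
  end.

Definition wire_vals (gs : seq gate) (inp : seq bool) : seq bool :=
  foldl (fun v g => rcons v (gate_val v g)) inp gs.

Definition circuit_eval (k : nat) (c : circuit k) (inp : seq bool) : seq bool :=
  [seq nth false (wire_vals (gates c) inp) a | a <- outputs c].

(* Every gate, including negation, adds one to the depth; inputs and constants
   have depth 0. *)
Definition gate_depth (d : seq nat) (g : gate) : nat :=
  match g with
  | GConst _ => 0
  | GNot a => (nth 0 d a).+1
  | GAnd a b | GOr a b => (maxn (nth 0 d a) (nth 0 d b)).+1
  end.

Definition wire_depths (k : nat) (gs : seq gate) : seq nat :=
  foldl (fun d g => rcons d (gate_depth d g)) (nseq k 0) gs.

Definition circuit_depth (k : nat) (c : circuit k) : nat :=
  \max_(d <- wire_depths k (gates c)) d.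

(* Pointwise representation: the concatenation of s 0, ..., s (t-1), each
   written in binary on ceil(log2 t) bits, least significant bit first. *)
Definition enc_width (t : nat) : nat := up_log 2 t.

Definition enc_point (t : nat) (i : 'I_t) : seq bool :=
  mkseq (fun k => odd (i %/ 2 ^ k)) (enc_width t).

Definition enc_perm (t : nat) (s : altg t) : seq bool :=
  flatten [seq enc_point (sgval s i) | i <- enum 'I_t].

Definition enc_vec (t n : nat) (x : n.-tuple (altg t)) : seq bool :=
  flatten [seq enc_perm s | s <- x].

(* A circuit is only required to be correct on valid encodings. *)
Definition circuit_computes (t m n : nat)
    (c : circuit (m * (t * enc_width t)))
    (f : m.-tuple (altg t) -> n.-tuple (altg t)) :=
  forall x : m.-tuple (altg t), circuit_eval c (enc_vec x) = enc_vec (f x).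

(* Main.v *)
Require Import Defs.
From mathcomp Require Import all_boot all_fingroup all_solvable.

Set Implicit Arguments.
Unset Strict Implicit.
Unset Printing Implicit Defensive.

(* If beta is a product of k conjugates of alpha and alpha^-1 in A_t, replace
   each factor (alpha^{+-1})^c by the word (x_1)^c ... (x_m)^c, respectively
   (x_m^-1)^c ... (x_1^-1)^c: its product is beta when the product of x is alpha,
   and id when the product of x is id. At most 4t conjugates suffice: every
   3-cycle is a product of at most 4 conjugates of alpha^{+-1}, by taking
   commutators with 3-cycles, and every even permutation is a product of at most
   t 3-cycles. As for the depth, bit k of the image of p under (y^{+-1})^c has
   the form "P i (y i) for some i", that is, a disjunction over t points of
   functions of log t bits. *)

(** * Products of conjugates of an element and its inverse *)

(* [b] is a product of at most [k] conjugates, by elements of [G], of [a] and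
   [a^-1]. *)
Inductive conj_prod (gT : finGroupType) (G : {group gT}) (a : gT) :
    nat -> gT -> Prop :=
  | ConjProd1 k : conj_prod G a k 1%g
  | ConjProdJ k b c : c \in G -> conj_prod G a k b ->
      conj_prod G a k.+1 (a ^ c * b)%g
  | ConjProdV k b c : c \in G -> conj_prod G a k b ->
      conj_prod G a k.+1 (a^-1 ^ c * b)%g.

Section ConjProd.
Local Open Scope group_scope.
Variables (gT : finGroupType) (G : {group gT}).
Implicit Types (a b c d : gT) (j k : nat).

Lemma conj_prod_le a j k b : j <= k -> conj_prod G a j b -> conj_prod G a k b.
Proof.
move=> le_jk ab; elim: ab k le_jk => {j b} [j | j b c Gc _ IH | j b c Gc _ IH] k.
- by move=> _; apply: ConjProd1.
- by case: k => // k le_jk; apply: ConjProdJ => //; apply: IH.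
- by case: k => // k le_jk; apply: ConjProdV => //; apply: IH.
Qed.

Lemma conj_prodM a j k b d :
  conj_prod G a j b -> conj_prod G a k d -> conj_prod G a (j + k) (b * d).
Proof.
move=> ab ad; elim: ab => {j b} [j | j b c Gc _ IH | j b c Gc _ IH].
- by rewrite mul1g; apply: conj_prod_le ad; apply: leq_addl.
- by rewrite -mulgA; apply: ConjProdJ.
- by rewrite -mulgA; apply: ConjProdV.
Qed.

Lemma conj_prod_id a c : c \in G -> conj_prod G a 1 (a ^ c).
Proof. by move=> Gc; rewrite -[a ^ c]mulg1; do 2?constructor. Qed.

Lemma conj_prod_inv a c : c \in G -> conj_prod G a 1 (a^-1 ^ c).
Proof. by move=> Gc; rewrite -[_ ^ c]mulg1; do 2?constructor. Qed.

Lemma conj_prodV a k b : conj_prod G a k b -> conj_prod G a k b^-1.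
Proof.
elim=> {k b} [k | k b c Gc _ IH | k b c Gc _ IH].
- by rewrite invg1; constructor.
- rewrite invMg -conjVg -addn1; apply: conj_prodM => //.
  exact: conj_prod_inv.
- rewrite invMg -conjVg invgK -addn1; apply: conj_prodM => //.
  exact: conj_prod_id.
Qed.

Lemma conj_prodJ a k b c :
  c \in G -> conj_prod G a k b -> conj_prod G a k (b ^ c).
Proof.
move=> Gc; elim=> {k b} [k | k b d Gd _ IH | k b d Gd _ IH].
- by rewrite conj1g; constructor.
- by rewrite conjMg -conjgM; apply: ConjProdJ; rewrite ?groupM.
- by rewrite conjMg -conjgM; apply: ConjProdV; rewrite ?groupM.
Qed.

(** Each of the [k] factors is a conjugate of [b] or [b^-1], hence again a product of [j]
    conjugates. Nesting two commutators thus costs [2 * 2]. *)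
Lemma conj_prod_trans a j k b d :
  conj_prod G a j b -> conj_prod G b k d -> conj_prod G a (j * k) d.
Proof.
move=> ab; elim=> {k d} [k | k d c Gc _ IH | k d c Gc _ IH].
- by constructor.
- by rewrite mulnS; apply: conj_prodM => //; apply: conj_prodJ.
- rewrite mulnS; apply: conj_prodM => //; apply: conj_prodJ => //.
  exact: conj_prodV.
Qed.

(** The commutator is [a^-1 ^ c] times [a] itself. *)
Lemma conj_prod_comm a c : c \in G -> conj_prod G a 2 [~ c, a].
Proof.
move=> Gc; have ->: [~ c, a] = a^-1 ^ c * a ^ 1.
  by rewrite commgEr conjg1 conjgE !mulgA.
by apply: ConjProdV => //; apply: conj_prod_id.
Qed.

End ConjProd.

(** * 3-cycles and even permutations as products of conjugates *)

Section ThreeCycles.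
Local Open Scope group_scope.
Variable T : finType.
Implicit Types (s : {perm T}) (x y z w v : T).

(* The cycle x -> y -> z -> x. *)
Definition cycle3 x y z : {perm T} := tperm x y * tperm x z.

Lemma cycle3J x y z s : cycle3 x y z ^ s = cycle3 (s x) (s y) (s z).
Proof. by rewrite conjMg !tpermJ. Qed.

Lemma cycle3V x y z : (cycle3 x y z)^-1 = cycle3 x z y.
Proof. by rewrite invMg !tpermV. Qed.

Lemma cycle3E1 x y z : uniq [:: x; y; z] -> cycle3 x y z x = y.
Proof.
rewrite /= !inE negb_or => /and3P[/andP[xy xz] yz _].
by rewrite permM tpermL tpermD // eq_sym.
Qed.

Lemma cycle3E2 x y z : cycle3 x y z y = z.
Proof. by rewrite permM tpermR tpermL. Qed.

Lemma cycle3E3 x y z : uniq [:: x; y; z] -> cycle3 x y z z = x.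
Proof.
rewrite /= !inE negb_or => /and3P[/andP[xy xz] yz _].
by rewrite permM (tpermD xz yz) tpermR.
Qed.

Lemma cycle3D x y z i : i \notin [:: x; y; z] -> cycle3 x y z i = i.
Proof.
rewrite !inE !negb_or => /and3P[ix iy iz].
by rewrite permM !tpermD // eq_sym.
Qed.

Lemma cycle3_Alt x y z : uniq [:: x; y; z] -> cycle3 x y z \in 'Alt_T.
Proof.
rewrite Alt_even odd_permM !odd_tperm /= !inE negb_or.
by case/andP=> /andP[-> ->].
Qed.

(** The alternating group is transitive on tuples of [#|T| - 2] distinct points, hence on triples
    once [5 <= #|T|]. *)
Lemma cycle3_conj x y z x' y' z' : 5 <= #|T| ->
  uniq [:: x; y; z] -> uniq [:: x'; y'; z'] ->
  exists2 s, s \in 'Alt_T & cycle3 x y z ^ s = cycle3 x' y' z'.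
Proof.
move=> T5 U U'.
have tr3 : [transitive^3 'Alt_T, on setT | 'P].
  apply: ntransitive_weak (Alt_trans T).
  by case: #|T| T5 => [|[|[|[|[|n]]]]].
have D : [tuple x; y; z] \in 3.-dtuple(setT).
  rewrite inE; apply/andP; split; first exact: U.
  by apply/subsetP=> i; rewrite inE.
have D' : [tuple x'; y'; z'] \in 3.-dtuple(setT).
  rewrite inE; apply/andP; split; first exact: U'.
  by apply/subsetP=> i; rewrite inE.
have [s As /(congr1 val) /= []] := atransP2 tr3 D D'.
by rewrite !apermE => -> -> ->; exists s => //; rewrite cycle3J.
Qed.


Lemma uniq3P x y z : x <> y -> x <> z -> y <> z -> uniq [:: x; y; z].
Proof.
move=> /eqP xy /eqP xz /eqP yz.
by rewrite /= !inE negb_or xy xz yz.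
Qed.

Lemma uniq4P x y z w : reflect
  [/\ x <> y, x <> z, x <> w & [/\ y <> z, y <> w & z <> w]]
  (uniq [:: x; y; z; w]).
Proof.
rewrite /= !inE !negb_or -!andbA; apply: (iffP idP).
  case/and5P=> /eqP? /eqP? /eqP? /eqP? /and3P[/eqP? /eqP? _].
  by split.
by case=> /eqP-> /eqP-> /eqP-> [/eqP-> /eqP-> /eqP->].
Qed.

(** Evaluates products of transpositions by splitting on which points coincide. Only variables are
    split on, so images such as [s x] are abstracted first. *)
Ltac perm_eval :=
  rewrite ?permM !permE /=;
  repeat (match goal with |- context [?u == ?v] =>
    is_var u; is_var v; case: (u =P v) => ? //=; try congruence end).

(** With c the cycle on [w], [x], [y], the commutator is [c^-1 * c ^ s], and [c ^ s] is the shifted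
    cycle on [x], [y], [z]. The product fixes [y]. *)
Lemma comm_cycle3_path s w x y z : uniq [:: w; x; y; z] ->
  s w = x -> s x = y -> s y = z -> [~ cycle3 w x y, s] = cycle3 w z x.
Proof.
move=> /uniq4P[? ? ? [? ? ?]] sw sx sy.
rewrite commgEl cycle3V cycle3J sw sx sy.
by apply/permP=> i; perm_eval.
Qed.

Lemma conj_prod_path s w x y z : uniq [:: w; x; y; z] ->
  s w = x -> s x = y -> s y = z -> conj_prod 'Alt_T s 2 (cycle3 w z x).
Proof.
move=> U sw sx sy; rewrite -(comm_cycle3_path U sw sx sy).
apply: conj_prod_comm; apply: cycle3_Alt.
by case/uniq4P: U => ? ? ? [? ? ?]; apply: uniq3P.
Qed.

(** Take [s (s x)] unless it equals [x]; in that case [s] swaps [x] and [s x], and must move a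
    further point, since a transposition is odd. *)
Lemma even_moves_third s x : s \in 'Alt_T -> s x != x ->
  exists z, [/\ z != x, z != s x & s z != z].
Proof.
move=> As sx; have [ssx | ssx] := eqVneq (s (s x)) x; last first.
  by exists (s (s x)); rewrite ssx !(inj_eq perm_inj).
have /existsP[z] : [exists z, s z != tperm x (s x) z].
  apply: contraLR As; rewrite negb_exists => /forallP eq_s.
  have -> : s = tperm x (s x) by apply/permP=> z; apply/eqP/negPn/eq_s.
  by rewrite Alt_even odd_tperm eq_sym sx.
case: tpermP => [-> | -> | zx zsx]; rewrite ?ssx ?eqxx //.
by exists z; split=> //; apply/eqP.
Qed.

(* A commutator [~ c, s] with a 3-cycle c is a product of two conjugates of s^-1
   and s. If s has a cycle of length at least 4, it is a 3-cycle for
   a suitable c; if s has a 3-cycle and moves another point, it can be made to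
   have a cycle of length 5; if s is an involution, it can be made a product of
   two transpositions, whose commutator with a 3-cycle sharing one of these
   transpositions is a 3-cycle. *)
Lemma conj_prod_cycle3_ex s : 5 <= #|T| -> s \in 'Alt_T -> s != 1 ->
  exists x y z, uniq [:: x; y; z] /\ conj_prod 'Alt_T s 4 (cycle3 x y z).
Proof.
move=> T5 As s_neq1.
have [/existsP[w U] | no4] :=
  boolP [exists w, uniq [:: w; s w; s (s w); s (s (s w))]].
  exists w, (s (s (s w))), (s w); split.
    by case/uniq4P: U => ? ? ? [? ? ?]; apply: uniq3P; congruence.
  by apply: (@conj_prod_le _ _ _ 2) => //; apply: (conj_prod_path U).
have [/existsP[x /andP[sx ssx]] | no3] :=
  boolP [exists x, (s x != x) && (s (s x) != x)].
  have sssx : s (s (s x)) = x.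
    apply/eqP/negPn; apply: contra no4 => sssx; apply/existsP; exists x.
    rewrite /= !inE !negb_or !(inj_eq perm_inj) ![x == _]eq_sym.
    by rewrite sx ssx sssx.
  move: sx ssx sssx; set y := s x; set z := s y => /eqP yx /eqP zx sz.
  have zy : z <> y by move/perm_inj.
  have [/existsP[w /andP[wD sw]] | fixed] :=
    boolP [exists w, (w \notin [:: x; y; z]) && (s w != w)]; last first.
    (* With no other moved point, [s] is itself this 3-cycle. *)
    exists x, y, z; split; first by apply: uniq3P; congruence.
    apply: (@conj_prod_le _ _ _ 1) => //.
    suff -> : cycle3 x y z = s ^ 1 by apply: conj_prod_id.
    rewrite conjg1; apply/permP=> i.
    have U : uniq [:: x; y; z] by apply: uniq3P; congruence.
    have [|iD] := boolP (i \in [:: x; y; z]).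
      by rewrite !inE => /or3P[] /eqP->; rewrite ?(cycle3E1, cycle3E2, cycle3E3).
    rewrite cycle3D //; apply/eqP; rewrite eq_sym; apply/negPn.
    by apply: contra fixed => si; apply/existsP; exists i; rewrite iD.
  move: wD sw; rewrite !inE !negb_or => /and3P[/eqP wx /eqP wy /eqP wz].
  set v := s w => /eqP vw.
  have vx : v <> x by rewrite -sz => /perm_inj.
  have vy : v <> y by move/perm_inj.
  have vz : v <> z by move/perm_inj.
  (* The commutator of [cycle3 x y w] with [s] is the 5-cycle x -> w -> z -> v -> y -> x; its path
     x, w, z, v yields the 3-cycle. *)
  have Uc : uniq [:: x; y; w] by apply: uniq3P; congruence.
  have c1 := conj_prod_comm s (cycle3_Alt Uc).
  exists x, v, w; split; first by apply: uniq3P; congruence.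
  apply: (@conj_prod_trans _ _ _ 2 2 _ _ c1).
  apply: (@conj_prod_path _ _ _ z).
  - by apply/uniq4P; split; try split; congruence.
  - by rewrite commgEl cycle3V cycle3J -/y -/z -/v; clearbody y z v; perm_eval.
  - by rewrite commgEl cycle3V cycle3J -/y -/z -/v; clearbody y z v; perm_eval.
  - by rewrite commgEl cycle3V cycle3J -/y -/z -/v; clearbody y z v; perm_eval.
have inv2 x : s (s x) = x.
  have [sx|sx] := eqVneq (s x) x; first by rewrite !sx.
  apply/eqP/negPn; apply: contra no3 => ssx; apply/existsP; exists x.
  by rewrite sx.
have [x sx] : exists x, s x != x.
  apply/existsP; apply: contraR s_neq1; rewrite negb_exists => /forallP fix_s.
  by apply/eqP/permP=> i; rewrite perm1; apply/eqP/negPn/fix_s.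
have [z [/eqP zx /eqP zsx /eqP sz]] := even_moves_third As sx.
have [v]: exists v, v \notin [:: x; s x; z; s z].
  apply/existsP; apply: contraLR T5.
  rewrite negb_exists -leqNgt => /forallP all4.
  rewrite (leq_trans _ (card_size [:: x; s x; z; s z])) // subset_leq_card //.
  by apply/subsetP=> i _; apply/negPn/all4.
rewrite !inE !negb_or => /and4P[/eqP vx /eqP vsx /eqP vz /eqP vsz].
move/eqP: sx => sx.
have Uc : uniq [:: x; s x; z] by apply: uniq3P; congruence.
have c1 := conj_prod_comm s (cycle3_Alt Uc).
have szx : s z <> x by move=> szx; apply: zsx; rewrite -szx inv2.
have szsx : s z <> s x by move/perm_inj.
have Ud : uniq [:: s x; s z; v] by apply: uniq3P; congruence.
exists (s x), (s z), v; split=> //.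
apply: (@conj_prod_trans _ _ _ 2 2 _ _ c1).
set u := [~ _, _].
have uE : u = tperm x z * tperm (s x) (s z).
  rewrite /u commgEl cycle3V cycle3J inv2.
  move: (s x) (s z) {inv2 no4 no3} zx zsx sz vx vsx vz vsz sx szx szsx.
  move=> y w *.
  by apply/permP=> i; perm_eval.
(* Since [u] swaps [s x] with [s z] and fixes [v], it inverts this 3-cycle d, so the commutator is
   d^-2 = d. *)
suff <- : [~ cycle3 (s x) (s z) v, u] = cycle3 (s x) (s z) v.
  by apply: conj_prod_comm; apply: cycle3_Alt.
rewrite commgEl cycle3V cycle3J uE.
move: (s x) (s z) {inv2 no4 no3 u uE Uc Ud} zx zsx sz vx vsx vz vsz sx szx szsx.
move=> y w *.
have -> : (tperm x z * tperm y w) y = w by perm_eval.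
have -> : (tperm x z * tperm y w) w = y by perm_eval.
have -> : (tperm x z * tperm y w) v = v by perm_eval.
by apply/permP=> i; perm_eval.
Qed.

(** All 3-cycles are conjugate in ['Alt_T], so the one already found suffices. *)
Lemma conj_prod_cycle3 s x y z : 5 <= #|T| -> s \in 'Alt_T -> s != 1 ->
  uniq [:: x; y; z] -> conj_prod 'Alt_T s 4 (cycle3 x y z).
Proof.
move=> T5 As s_neq1 U.
have [a [b [c [U' sabc]]]] := conj_prod_cycle3_ex T5 As s_neq1.
have [u Au <-] := cycle3_conj T5 U' U.
exact: conj_prodJ.
Qed.

(* Multiplying by the 3-cycle b x -> x -> z -> b x makes x a fixed point and, for
   z moved by b, creates no new moved point. *)
Lemma conj_prod_Alt_moved s b k : 5 <= #|T| -> s \in 'Alt_T -> s != 1 ->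
  b \in 'Alt_T -> #|[set x | b x != x]| <= k -> conj_prod 'Alt_T s (4 * k) b.
Proof.
move=> T5 As s_neq1; elim: k b => [|k IH] b Ab mv.
  suff -> : b = 1 by constructor.
  apply/permP=> x; rewrite perm1; apply/eqP/negPn.
  move: mv; rewrite leqn0 cards_eq0.
  by move/eqP/setP/(_ x); rewrite !inE => ->.
have [/existsP[x bx] | fixed] := boolP [exists x, b x != x]; last first.
  suff -> : b = 1 by constructor.
  apply/permP=> x; rewrite perm1; apply/eqP/negPn.
  by apply: contra fixed => bx; apply/existsP; exists x.
have [z [zx zbx bz]] := even_moves_third Ab bx.
have U : uniq [:: b x; x; z].
  by rewrite /= !inE negb_or bx !(eq_sym _ z) zbx zx.
set c := cycle3 (b x) x z in U *.
have Ac : c \in 'Alt_T by apply: cycle3_Alt.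
rewrite -(mulgK c b) mulnS addnC; apply: conj_prodM; last first.
  by apply: conj_prodV; apply: conj_prod_cycle3.
apply: IH; first by rewrite groupM.
rewrite -ltnS; apply: leq_trans mv; apply: proper_card; apply/properP; split.
  (* A fixed point of [b] is none of [b x], [x], [z], all moved by [b], so [c] fixes it too. *)
  apply/subsetP=> i; rewrite !inE permM; apply: contra => /eqP bi.
  rewrite bi cycle3D // !inE !negb_or; apply/and3P; split.
  - by apply: contraNneq bx => ii; rewrite -(inj_eq (@perm_inj _ b)) -ii bi.
  - by apply: contraNneq bx => <-; rewrite bi.
  - by apply: contraNneq bz => <-; rewrite bi.
by exists x; rewrite !inE // permM cycle3E1 ?eqxx.
Qed.

End ThreeCycles.

(** * Boolean formulas and their compilation into circuits *)

(** Trees can be built and measured by recursion; they follow the depth conventions of gates, so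
    compilation preserves depth bounds. *)
Inductive formula :=
  | FConst of bool
  | FVar of nat
  | FNot of formula
  | FAnd of formula & formula
  | FOr of formula & formula.

Fixpoint formula_eval (env : nat -> bool) (f : formula) : bool :=
  match f with
  | FConst b => b
  | FVar a => env a
  | FNot f => ~~ formula_eval env f
  | FAnd f g => formula_eval env f && formula_eval env g
  | FOr f g => formula_eval env f || formula_eval env g
  end.

Fixpoint formula_depth (f : formula) : nat :=
  match f with
  | FConst _ | FVar _ => 0
  | FNot f => (formula_depth f).+1
  | FAnd f g | FOr f g => (maxn (formula_depth f) (formula_depth g)).+1
  end.

Fixpoint formula_wf (k : nat) (f : formula) : bool :=
  match f with
  | FConst _ => true
  | FVar a => a < k
  | FNot f => formula_wf k f
  | FAnd f g | FOr f g => formula_wf k f && formula_wf k g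
  end.

(* Specializes to both [wire_vals] and [wire_depths]. *)
Section Run.
Variables (A : Type) (step : seq A -> gate -> A).

Definition run (inp : seq A) (gs : seq gate) : seq A :=
  foldl (fun v g => rcons v (step v g)) inp gs.

Lemma run_rcons inp gs g :
  run inp (rcons gs g) = rcons (run inp gs) (step (run inp gs) g).
Proof. by rewrite /run foldl_rcons. Qed.

Lemma size_run inp gs : size (run inp gs) = size inp + size gs.
Proof.
elim/last_ind: gs => [|gs g IH]; first by rewrite addn0.
by rewrite run_rcons !size_rcons IH addnS.
Qed.

Lemma nth_run_cat x0 inp gs gs' o : o < size inp + size gs ->
  nth x0 (run inp (gs ++ gs')) o = nth x0 (run inp gs) o.
Proof.
move=> lt_o; elim/last_ind: gs' => [|gs' g IH]; first by rewrite cats0.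
rewrite -rcons_cat run_rcons nth_rcons size_run size_cat IH.
by rewrite addnA (leq_trans lt_o (leq_addr _ _)).
Qed.

End Run.

Lemma wire_valsE gs inp : wire_vals gs inp = run gate_val inp gs.
Proof. by []. Qed.

Lemma wire_depthsE k gs : wire_depths k gs = run gate_depth (nseq k 0) gs.
Proof. by []. Qed.

Lemma gates_wf_rcons w gs g :
  gates_wf w (rcons gs g) =
  gates_wf w gs && all (fun a => a < w + size gs) (gate_reads g).
Proof.
elim: gs w => [|h gs IH] w /=; first by rewrite addn0 andbT.
by rewrite IH andbA addSnnS.
Qed.

Section Compile.
Variable k d : nat.

(** All wires are bounded, because [circuit_depth] takes the maximum over every wire and not just
    the outputs. *)
Definition compiled (gs : seq gate) : bool :=
  gates_wf k gs && all (fun e => e <= d) (wire_depths k gs).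

Definition drives (gs : seq gate) (o : nat) (f : formula) : Prop :=
  [/\ o < k + size gs,
      nth 0 (wire_depths k gs) o <= formula_depth f
    & forall inp, size inp = k ->
      nth false (wire_vals gs inp) o = formula_eval (nth false inp) f].

Lemma drives_cat gs gs' o f : drives gs o f -> drives (gs ++ gs') o f.
Proof.
case=> lt_o dep val; split.
- by rewrite size_cat addnA (leq_trans lt_o) ?leq_addr.
- by rewrite !wire_depthsE nth_run_cat ?size_nseq.
- move=> inp sz; rewrite -val //.
  by rewrite !wire_valsE nth_run_cat ?sz.
Qed.

(** The step shared by all cases of [compile_formula] that emit a gate. *)
Lemma drives_gate gs g f :
  compiled gs -> all (fun a => a < k + size gs) (gate_reads g) ->
  gate_depth (wire_depths k gs) g <= formula_depth f -> formula_depth f <= d ->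
  (forall inp, size inp = k ->
    gate_val (wire_vals gs inp) g = formula_eval (nth false inp) f) ->
  compiled (rcons gs g) /\ drives (rcons gs g) (k + size gs) f.
Proof.
move=> /andP[wf dep] reads_g dep_g dep_f val_g.
have szd : size (wire_depths k gs) = k + size gs.
  by rewrite wire_depthsE size_run size_nseq.
split.
  rewrite /compiled gates_wf_rcons wf reads_g.
  rewrite !wire_depthsE run_rcons all_rcons.
  by rewrite (leq_trans dep_g dep_f).
split.
- by rewrite size_rcons addnS.
- by rewrite !wire_depthsE run_rcons nth_rcons szd ltnn eqxx.
- move=> inp sz; rewrite !wire_valsE run_rcons nth_rcons.
  by rewrite size_run sz ltnn eqxx; apply: val_g.
Qed.

(** Stated after arbitrary earlier gates [gs], so that the second operand can be compiled behind the
    first; appending gates leaves earlier wires intact. A variable emits no gate: its input wire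
    serves. *)
Lemma compile_formula f gs :
  formula_wf k f -> formula_depth f <= d -> compiled gs ->
  exists gs' o, compiled (gs ++ gs') /\ drives (gs ++ gs') o f.
Proof.
elim: f gs => [b | a | f IHf | f IHf g IHg | f IHf g IHg] gs /= wf dep ok.
- exists [:: GConst b], (k + size gs); rewrite cats1.
  exact: drives_gate.
- exists [::], a; rewrite cats0; split=> //; split.
  + by rewrite ltn_addr.
  + rewrite wire_depthsE -[gs]cat0s nth_run_cat /= ?addn0 ?size_nseq //.
    by rewrite nth_nseq wf.
  + move=> inp sz.
    by rewrite wire_valsE -[gs]cat0s nth_run_cat //= addn0 sz.
- have [gs' [o [ok' [lt_o dep_o val_o]]]] := IHf gs wf (ltnW dep) ok.
  exists (rcons gs' (GNot o)), (k + size (gs ++ gs')); rewrite -rcons_cat.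
  apply: drives_gate => //=; first by rewrite lt_o.
  by move=> inp sz; rewrite val_o.
- move: wf dep; rewrite gtn_max => /andP[wf_f wf_g] /andP[dep_f dep_g].
  have [g1 [o1 [ok1 dr1]]] := IHf gs wf_f (ltnW dep_f) ok.
  have [g2 [o2 [ok2 [lt2 dep2 val2]]]] := IHg _ wf_g (ltnW dep_g) ok1.
  have [lt1 dep1 val1] := drives_cat g2 dr1.
  exists (rcons (g1 ++ g2) (GAnd o1 o2)), (k + size ((gs ++ g1) ++ g2)).
  rewrite -rcons_cat catA; apply: drives_gate => //=.
  + by rewrite lt1 lt2.
  + by rewrite ltnS geq_max !leq_max dep1 dep2 orbT.
  + by rewrite gtn_max dep_f.
  + by move=> inp sz; rewrite val1 ?val2.
- move: wf dep; rewrite gtn_max => /andP[wf_f wf_g] /andP[dep_f dep_g].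
  have [g1 [o1 [ok1 dr1]]] := IHf gs wf_f (ltnW dep_f) ok.
  have [g2 [o2 [ok2 [lt2 dep2 val2]]]] := IHg _ wf_g (ltnW dep_g) ok1.
  have [lt1 dep1 val1] := drives_cat g2 dr1.
  exists (rcons (g1 ++ g2) (GOr o1 o2)), (k + size ((gs ++ g1) ++ g2)).
  rewrite -rcons_cat catA; apply: drives_gate => //=.
  + by rewrite lt1 lt2.
  + by rewrite ltnS geq_max !leq_max dep1 dep2 orbT.
  + by rewrite gtn_max dep_f.
  + by move=> inp sz; rewrite val1 ?val2.
Qed.

Lemma compile_formulas fs gs :
  all (formula_wf k) fs -> all (fun f => formula_depth f <= d) fs ->
  compiled gs ->
  exists gs' os, [/\ compiled (gs ++ gs'),
    all (fun o => o < k + size (gs ++ gs')) os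
    & forall inp, size inp = k ->
      [seq nth false (wire_vals (gs ++ gs') inp) o | o <- os] =
      [seq formula_eval (nth false inp) f | f <- fs]].
Proof.
elim: fs gs => [|f fs IH] gs /=.
  by move=> _ _ ok; exists [::], [::]; rewrite cats0.
move=> /andP[wf wfs] /andP[dep deps] ok.
have [g1 [o [ok1 dr]]] := compile_formula wf dep ok.
have [g2 [os [ok2 lt_os val_os]]] := IH _ wfs deps ok1.
have [lt_o _ val_o] := drives_cat g2 dr.
exists (g1 ++ g2), (o :: os); rewrite catA; split=> //=; first by rewrite lt_o.
by move=> inp sz; rewrite val_o // val_os.
Qed.

Lemma circuit_of_formulas fs :
  all (formula_wf k) fs -> all (fun f => formula_depth f <= d) fs ->
  exists2 c : circuit k, circuit_depth c <= d &
    forall inp, size inp = k ->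
      circuit_eval c inp = [seq formula_eval (nth false inp) f | f <- fs].
Proof.
move=> wfs deps.
have ok0 : compiled [::] by apply/andP; split=> //=; apply/allP=> e /nseqP[->].
have [gs [os [/andP[wf dep] lt_os val_os]]] := compile_formulas wfs deps ok0.
exists (Circuit wf lt_os) => //=.
by apply/bigmax_leqP_seq=> e e_in _; apply: (allP dep).
Qed.

End Compile.

(** * Lookup tables and balanced disjunctions *)

(* Reads [w] bits starting at wire [off], least significant first, and applies
   [P] to the number they encode. *)
Fixpoint table (w off : nat) (P : nat -> bool) : formula :=
  if w is w'.+1 then
    FOr (FAnd (FVar off) (table w' off.+1 (fun v => P v.*2.+1)))
        (FAnd (FNot (FVar off)) (table w' off.+1 (fun v => P v.*2)))
  else FConst (P 0).

(** Per bit, 3 covers the disjunction, the conjunction and the negation. *)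
Lemma table_depth w off P : formula_depth (table w off P) <= 3 * w.
Proof.
elim: w off P => //= w IH off P; rewrite max0n mulnS !addSn add0n.
by rewrite ltnS geq_max !ltnS geq_max /= ltnW ?ltnS ?IH //= ltnW ?ltnS ?IH.
Qed.

Lemma table_wf k w off P : off + w <= k -> formula_wf k (table w off P).
Proof.
elim: w off P => //= w IH off P; rewrite addnS => le_k.
by rewrite !IH ?addSn // !andbT andbb (leq_trans _ le_k) // ltnS leq_addr.
Qed.

(** Wire [off] carries the parity of [v] and the remaining wires carry the bits of [v./2], to which
    the induction applies. *)
Lemma table_eval w off P env v : v < 2 ^ w ->
  (forall j, j < w -> env (off + j) = odd (v %/ 2 ^ j)) ->
  formula_eval env (table w off P) = P v.
Proof.
elim: w off P v => [|w IH] off P v /=; first by rewrite ltnS leqn0 => /eqP->.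
move=> lt_v bits.
have odd_v : env off = odd v by have := bits 0 isT; rewrite addn0 divn1.
have tail Q : formula_eval env (table w off.+1 Q) = Q v./2.
  apply: IH => [|j lt_j].
    by rewrite ltn_half_double -mul2n -expnS.
  by rewrite addSnnS bits // -divn2 -divnMA -expnS.
rewrite !tail odd_v -[v in RHS]odd_double_half.
by case: (odd v); rewrite //= orbF.
Qed.

(** A balanced tree over the [2 ^ k] indices from [a], which adds only [k] to the depth. *)
Fixpoint disj (k a : nat) (F : nat -> formula) : formula :=
  if k is k'.+1 then FOr (disj k' a F) (disj k' (a + 2 ^ k') F) else F a.

Lemma disj_depth k a F d :
  (forall i, formula_depth (F i) <= d) -> formula_depth (disj k a F) <= d + k.
Proof.
move=> dep; elim: k a => [|k IH] a /=; first by rewrite addn0.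
by rewrite addnS ltnS geq_max !IH.
Qed.

Lemma disj_wf n k a F :
  (forall i, formula_wf n (F i)) -> formula_wf n (disj k a F).
Proof. by move=> wf; elim: k a => //= k IH a; rewrite !IH. Qed.

Lemma disj_eval k a F env :
  formula_eval env (disj k a F) =
  has (fun i => formula_eval env (F i)) (iota a (2 ^ k)).
Proof.
elim: k a => [|k IH] a /=; first by rewrite orbF.
by rewrite !IH expnS mul2n -addnn iotaD has_cat.
Qed.

(** * Pointwise encodings and formulas reading them *)

Lemma size_flatten_block (A : Type) (n : nat) (ss : seq (seq A)) :
  all (fun s => size s == n) ss -> size (flatten ss) = size ss * n.
Proof.
elim: ss => //= s ss IH /andP[/eqP sz all_n].
by rewrite size_cat IH // sz mulSn.
Qed.

Lemma nth_flatten_block (A : Type) (a0 : A) (n i j : nat) (ss : seq (seq A)) :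
  all (fun s => size s == n) ss -> i < size ss -> j < n ->
  nth a0 (flatten ss) (i * n + j) = nth a0 (nth [::] ss i) j.
Proof.
elim: ss i => //= s ss IH [|i] /andP[/eqP sz all_n] lt_i lt_j.
  by rewrite nth_cat sz lt_j.
by rewrite mulSn -addnA nth_cat sz ltnNge leq_addr /= addKn IH.
Qed.

Lemma all_flatten (A : Type) (P : pred A) (ss : seq (seq A)) :
  all P (flatten ss) = all (all P) ss.
Proof. by elim: ss => //= s ss IH; rewrite all_cat IH. Qed.

Section Encoding.
Variable t : nat.
Local Notation w := (enc_width t).

Lemma size_enc_perm (s : altg t) : size (enc_perm s) = t * w.
Proof.
rewrite /enc_perm (@size_flatten_block _ w) 1?size_map ?size_enum_ord //.
by rewrite all_map; apply/allP=> p _ /=; rewrite size_mkseq.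
Qed.

Lemma size_enc_vec m (x : m.-tuple (altg t)) : size (enc_vec x) = m * (t * w).
Proof.
rewrite /enc_vec (@size_flatten_block _ (t * w)) ?size_map ?size_tuple //.
by rewrite all_map; apply/allP=> s _ /=; rewrite size_enc_perm.
Qed.

Lemma nth_enc_perm (s : altg t) (p : 'I_t) j : j < w ->
  nth false (enc_perm s) (p * w + j) = odd (sgval s p %/ 2 ^ j).
Proof.
move=> lt_j; rewrite nth_flatten_block 1?size_map ?size_enum_ord //.
  by rewrite (nth_map p) ?size_enum_ord // nth_ord_enum nth_mkseq.
by rewrite all_map; apply/allP=> q _ /=; rewrite size_mkseq.
Qed.

Lemma nth_enc_vec m (x : m.-tuple (altg t)) (i : 'I_m) (p : 'I_t) j : j < w ->
  nth false (enc_vec x) (i * (t * w) + p * w + j) =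
  odd (sgval (tnth x i) p %/ 2 ^ j).
Proof.
move=> lt_j; rewrite -addnA nth_flatten_block ?size_map ?size_tuple //.
- by rewrite (nth_map 1%g) ?size_tuple // -tnth_nth nth_enc_perm.
- by rewrite all_map; apply/allP=> s _ /=; rewrite size_enc_perm.
- rewrite (@leq_trans (p.+1 * w)) //; first by rewrite mulSn addnC ltn_add2r.
  by rewrite leq_mul2r ltn_ord orbT.
Qed.

Lemma ltn_pow_enc_width (p : 'I_t) : p < 2 ^ w.
Proof. exact: leq_trans (ltn_ord p) (up_logP _ _). Qed.

(* Decides whether some point [p] is related by [P] to its image under the
   [i]-th input permutation. *)
Definition graph_formula m (i : 'I_m) (P : rel 'I_t) : formula :=
  disj w 0 (fun p => if insub p is Some p' then
    table w (i * (t * w) + p * w)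
      (fun v => if insub v is Some v' then P p' v' else false)
    else FConst false).

(** At most [3 * w] for a table and [w] for the disjunction above it. *)
Lemma graph_formula_depth m (i : 'I_m) P :
  formula_depth (graph_formula i P) <= 4 * w.
Proof.
rewrite mulSn addnC; apply: disj_depth => p.
by case: insubP => // *; apply: table_depth.
Qed.

Lemma graph_formula_wf m (i : 'I_m) P :
  formula_wf (m * (t * w)) (graph_formula i P).
Proof.
apply: disj_wf => p; case: insubP => // p' lt_p _; apply: table_wf.
rewrite -addnA -mulSnr (@leq_trans (i.+1 * (t * w))) //.
  by rewrite [leqRHS]mulSnr leq_add2l leq_mul2r lt_p orbT.
by rewrite leq_mul2r ltn_ord orbT.
Qed.

(** The disjunction runs over [2 ^ w] indices; those from [t] on name no point and contribute
    false. *)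
Lemma graph_formula_eval m (x : m.-tuple (altg t)) (i : 'I_m) P :
  formula_eval (nth false (enc_vec x)) (graph_formula i P) =
  [exists p, P p (sgval (tnth x i) p)].
Proof.
have row (p : 'I_t) Q : formula_eval (nth false (enc_vec x))
    (table w (i * (t * w) + p * w) Q) = Q (sgval (tnth x i) p).
  apply: table_eval => [|j lt_j]; first exact: ltn_pow_enc_width.
  exact: nth_enc_vec.
rewrite disj_eval; apply/hasP/existsP => [[p _] | [p Pp]].
  by case: insubP => // p' _ <-; rewrite row valK; exists p'.
exists (p : nat); first by rewrite mem_iota /= ltn_pow_enc_width.
by rewrite valK row valK.
Qed.

End Encoding.

(** * Words in conjugates of the inputs *)

Lemma prod_revV (gT : finGroupType) (I : Type) (r : seq I) (F : I -> gT) :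
  (\prod_(i <- rev r) (F i)^-1 = (\prod_(i <- r) F i)^-1)%g.
Proof.
elim: r => [|i r IH]; first by rewrite !big_nil invg1.
by rewrite rev_cons -cats1 big_cat big_seq1 IH big_cons invMg.
Qed.

Section Codes.
Variables t m : nat.

(* The letter [(i, b, c)] stands for the conjugate by [c] of the [i]-th input,
   inverted if [b] holds. *)
Definition letter := ('I_m * bool * altg t)%type.

Definition letter_val (x : m.-tuple (altg t)) (q : letter) : altg t :=
  ((if q.1.2 then (tnth x q.1.1)^-1 else tnth x q.1.1) ^ q.2)%g.

(** With r = c^-1 p, the letter of an input y sends [p] to c (y r), or to c (y^-1 r) if inverted.
    The first case fixes the argument [i] as r and reads the image; the second finds y^-1 r as the
    point [i] whose image [v] is r, so no inverse need be computed. *)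
Definition letter_bit (q : letter) (p : 'I_t) (k : nat) : rel 'I_t :=
  fun i v => let c := sgval q.2 in
  if q.1.2 then (v == (c^-1)%g p) && odd (c i %/ 2 ^ k)
  else (i == (c^-1)%g p) && odd (c v %/ 2 ^ k).

Lemma letter_bitP (x : m.-tuple (altg t)) (q : letter) p k :
  [exists i, letter_bit q p k i (sgval (tnth x q.1.1) i)] =
  odd (sgval (letter_val x q) p %/ 2 ^ k).
Proof.
case: q => [[i b] c]; rewrite /letter_bit /letter_val /=.
set y := tnth x i.
have valJ (z : altg t) :
    sgval (z ^ c)%g p = sgval c (sgval z ((sgval c)^-1%g p)).
  by rewrite morphJ ?inE // conjgE !permM.
rewrite valJ; case: b.
  rewrite morphV ?inE //=; set r := ((sgval c)^-1)%g p; apply/existsP/idP.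
    by case=> j /andP[/eqP <-]; rewrite permK.
  by move=> odd_r; exists ((sgval y)^-1%g r); rewrite permKV eqxx.
apply/existsP/idP => [[j /andP[/eqP->]] | y_odd] //.
by exists ((sgval c)^-1%g p); rewrite eqxx.
Qed.

Definition code_fun (s : seq letter) (x : m.-tuple (altg t)) :
    (size s).-tuple (altg t) :=
  map_tuple (letter_val x) (in_tuple s).

Lemma code_fun_local s : one_local (code_fun s).
Proof.
move=> j; exists (tnth (in_tuple s) j).1.1 => x y xy.
by rewrite !tnth_map /letter_val xy.
Qed.

Lemma code_fun_circuit s :
  exists2 c : circuit (m * (t * enc_width t)),
    circuit_depth c <= 4 * enc_width t & circuit_computes c (code_fun s).
Proof.
(* One formula per output bit, nested in the order of [enc_vec]. *)
pose fs := flatten [seq flatten [seq mkseq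
  (fun k => graph_formula q.1.1 (letter_bit q p k)) (enc_width t)
  | p <- enum 'I_t] | q <- s].
have all_fs (P : pred formula) :
    (forall q (i : 'I_m) p k, P (graph_formula i (letter_bit q p k))) -> all P fs.
  move=> PP; rewrite all_flatten all_map; apply/allP=> q _ /=.
  rewrite all_flatten all_map; apply/allP=> p _ /=.
  by rewrite all_map; apply/allP=> k _ /=; apply: PP.
have [c dep_c eval_c] := circuit_of_formulas
  (all_fs _ (fun _ i _ _ => graph_formula_wf i _))
  (all_fs _ (fun _ i _ _ => graph_formula_depth i _)).
exists c => // x; rewrite eval_c ?size_enc_vec // /fs /enc_vec map_flatten.
rewrite -!map_comp.
congr flatten; apply: eq_map => q /=; rewrite map_flatten -map_comp.
congr flatten; apply: eq_map => p /=; rewrite -map_comp.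
by apply: eq_map => k /=; rewrite graph_formula_eval letter_bitP.
Qed.

Definition conj_block (b : bool) (c : altg t) : seq letter :=
  [seq (i, b, c) | i <- if b then rev (enum 'I_m) else enum 'I_m].

Lemma size_conj_block b c : size (conj_block b c) = m.
Proof. by case: b; rewrite size_map ?size_rev size_enum_ord. Qed.

Lemma prod_conj_block b c x :
  (\prod_(q <- conj_block b c) letter_val x q =
   (if b then (vprod x)^-1 else vprod x) ^ c)%g.
Proof.
have prodJ r (F : 'I_m -> altg t) :
    (\prod_(i <- r) F i ^ c = (\prod_(i <- r) F i) ^ c)%g.
  by rewrite (big_morph (conjg^~ c) (fun y z => conjMg y z c) (conj1g c)).
rewrite big_map /letter_val prodJ; congr (_ ^ c)%g.
have vprodE : (\prod_(i <- enum 'I_m) tnth x i)%g = vprod x.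
  by rewrite /vprod [index_enum _]unlock -enumT.
by case: b; rewrite /= ?prod_revV vprodE.
Qed.

(** By induction on the derivation, each factor becomes a [conj_block] of [m] letters. *)
Lemma code_of_conj_prod (alpha : altg t) k b :
  conj_prod 'Alt_('I_t) (sgval alpha) k b ->
  exists2 s : seq letter, size s <= k * m & forall x,
    (vprod x = alpha -> sgval (\prod_(q <- s) letter_val x q)%g = b) /\
    (vprod x = 1%g -> (\prod_(q <- s) letter_val x q)%g = 1%g).
Proof.
elim=> {k b} [k | k b c Ac _ [s sz sP] | k b c Ac _ [s sz sP]].
- by exists [::] => // x; rewrite big_nil morph1.
- exists (conj_block false (subg _ c) ++ s).
    by rewrite size_cat size_conj_block mulSn leq_add2l.
  move=> x; have [sa s1] := sP x; rewrite big_cat prod_conj_block /=.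
  split=> vx; last by rewrite vx conj1g s1 // mulg1.
  by rewrite subgK // sa // vx conjgE.
- exists (conj_block true (subg _ c) ++ s).
    by rewrite size_cat size_conj_block mulSn leq_add2l.
  move=> x; have [sa s1] := sP x; rewrite big_cat prod_conj_block /=.
  split=> vx; last by rewrite vx invg1 conj1g s1 // mulg1.
  by rewrite subgK // sa // vx conjgE.
Qed.

End Codes.

(** * Logarithmic bounds and choice of constants *)

(** Rounding the logarithm up instead of down costs at most 1, and [trunc_log 2 t] is at least 1. *)
Lemma enc_width_le t : 1 < t -> enc_width t <= 2 * trunc_log 2 t.
Proof.
move=> t_gt1; apply: (@leq_trans (trunc_log 2 t).+1).
  by apply: up_log_min => //; apply/ltnW/trunc_log_ltn.
by rewrite mul2n -addnn -addn1 leq_add2l trunc_log_max.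
Qed.

Theorem theorem2p1 :
  exists C D : nat,
  forall t : nat, t = 2 %[mod 4] ->
  forall alpha beta : altg t, alpha != 1%g -> beta != 1%g ->
  forall m : nat,
  exists (n : nat) (f : m.-tuple (altg t) -> n.-tuple (altg t)),
    [/\ n <= C * (t * m),
        one_local f,
        exists c : circuit (m * (t * enc_width t)),
          circuit_depth c <= D * trunc_log 2 t /\ circuit_computes c f
      & forall x : m.-tuple (altg t),
          (vprod x = alpha -> vprod (f x) = beta) /\
          (vprod x = 1%g -> vprod (f x) = 1%g)].
Proof.
(* There are [4 * t] blocks of [m] letters; depth [4 * enc_width t] is at most
   [4 * (2 * trunc_log 2 t)]. *)
exists 4, 8 => t t_mod alpha beta alpha1 _ m.
have val_alpha1 : sgval alpha != 1%g.
  by rewrite -(inj_eq val_inj) in alpha1.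
(* Below 5 the congruence leaves only t = 2, where the alternating group is trivial, against
   [alpha != 1]. *)
have t5 : 5 <= t.
  case: t t_mod alpha beta alpha1 m val_alpha1 => [|[|[|[|[|t]]]]] //.
  move=> _ alpha _ _ _ /eqP[]; apply/set1gP.
  rewrite -(@trivial_Alt_2 'I_2) ?card_ord //; exact: subgP.
have T5 : 5 <= #|'I_t| by rewrite card_ord.
have beta_prod : conj_prod 'Alt_('I_t) (sgval alpha) (4 * t) (sgval beta).
  apply: conj_prod_Alt_moved => //; try exact: subgP.
  by rewrite (leq_trans (max_card _)) ?card_ord.
have [s sz sP] := code_of_conj_prod m beta_prod.
have vprod_code x : vprod (code_fun s x) = (\prod_(q <- s) letter_val x q)%g.
  by rewrite /vprod -(big_tuple _ _ (code_fun s x) predT id) /= big_map.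
exists (size s), (code_fun s); split.
- by rewrite mulnA.
- exact: code_fun_local.
- have [c dep_c comp_c] := code_fun_circuit s; exists c; split=> //.
  rewrite (leq_trans dep_c) // (@leq_trans (4 * (2 * trunc_log 2 t))) //.
    by rewrite leq_mul2l enc_width_le // (leq_trans _ t5).
  by rewrite mulnA.
- move=> x; have [sa s1] := sP x; rewrite vprod_code; split=> // vx.
  by apply: val_inj; apply: sa.
Qed.
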